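(* Let $\beta,\gamma>0$ and let $\Lambda=(\lambda_j)_{j\in\mathbb{Z}}\subseteq\mathbb{R}$ be an increasing separated sequence of uniform density $D(\Lambda)<2\beta^{-1}$. Then there exist linearly independent real-valued functions $f,g\in V^\infty_\beta(\phi_\gamma)$ such that $|f(\lambda)|=|g(\lambda)|$ for all $\lambda\in\Lambda$.
   Context: For $\gamma>0$ let $\phi_\gamma(x)=e^{-\gamma x^2}$, $x\in\mathbb{R}$. For $\beta>0$, $V^\infty_\beta(\phi_\gamma)$ is the space of all functions $f:\mathbb{R}\to\mathbb{C}$ of the form $f(x)=\sum_{k\in\mathbb{Z}}c_k e^{-\gamma(x-\beta k)^2}$ with $c=(c_k)\in\ell^\infty(\mathbb{Z})$. A set $\Lambda\subseteq\mathbb{R}$ is separated if $\inf\{|\lambda-\lambda'|:\lambda,\lambda'\in\Lambda,\ \lambda\neq\lambda'\}>0$. The lower and upper Beurling densities are $D^-(\Lambda)=\liminf_{r\to\infty}\inf_{x\in\mathbb{R}}\frac{\#(\Lambda\cap[x-r,x+r])}{2r}$ and $D^+(\Lambda)=\limsup_{r\to\infty}\sup_{x\in\mathbb{R}}\frac{\#(\Lambda\cap[x-r,x+r])}{2r}$. $\Lambda$ has uniform density $D(\Lambda)$ if $D^-(\Lambda)=D^+(\Lambda)=:D(\Lambda)$. *)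

(* Defs.v *)
From HB Require Import structures.
From mathcomp Require Import all_boot all_order all_algebra finmap.
From mathcomp Require Import complex.
From mathcomp Require Import all_classical all_reals all_analysis.
From mathcomp Require Export showcase.summability.

Set Implicit Arguments.
Unset Strict Implicit.
Unset Printing Implicit Defensive.

Import Order.TTheory GRing.Theory Num.Theory.
Import numFieldNormedType.Exports.

Local Open Scope classical_set_scope.
Local Open Scope ring_scope.

Definition gaussian (R : realType) (gamma x : R) : R := expR (- gamma * x ^+ 2).

Definition bounded_seq (R : realType) (c : int -> R[i]) : Prop :=
  exists M : R, forall k : int, `|c k| <= M%:C%C.

(* The series over Z converges unconditionally, i.e. along the finite subsets
   of int ordered by inclusion; for beta, gamma > 0 and bounded c it converges
   absolutely, so no summation order is being privileged. *)
Definition Vinfty (R : realType) (beta gamma : R) : set (R -> R[i]) :=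
  [set f : R -> R[i] | exists c : int -> R[i], bounded_seq c /\
    forall x : R,
      partial_sum
        (fun k : int => c k * (gaussian gamma (x - beta * k%:~R))%:C%C : R[i])
        @ totally --> (f x : (R[i])^o)].

(* The infimum is taken in \bar R, so that sets with at most one point, for
   which it is +oo, are separated. *)
Definition separated_set (R : realType) (L : set R) : Prop :=
  (0 < ereal_inf [set d | exists l l' : R,
         [/\ L l, L l', l <> l' & d = `|l - l'|%:E]])%E.

Definition window_density (R : realType) (L : set R) (r x : R) : \bar R :=
  (counting (L `&` [set y | (x - r <= y <= x + r)%R]) * ((2 * r)^-1)%R%:E)%E.

Definition lower_beurling_density (R : realType) (L : set R) : \bar R :=
  limf_einf (fun r : R => ereal_inf (range (window_density L r)))
            (pinfty_nbhs R).

Definition upper_beurling_density (R : realType) (L : set R) : \bar R :=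
  limf_esup (fun r : R => ereal_sup (range (window_density L r)))
            (pinfty_nbhs R).

Definition has_uniform_density (R : realType) (L : set R) (D : \bar R) : Prop :=
  lower_beurling_density L = D /\ upper_beurling_density L = D.

Definition real_valued (R : realType) (f : R -> R[i]) : Prop :=
  forall x : R, f x \is Num.real.

(* Independence over the complex numbers, the scalar field of Vinfty; for
   real-valued functions it is equivalent to independence over R. *)
Definition lin_indep2 (R : realType) (f g : R -> R[i]) : Prop :=
  forall a b : R[i], (forall x : R, a * f x + b * g x = 0) -> a = 0 /\ b = 0.

(* Main.v *)
Require Import Defs.
From mathcomp Require Import all_boot all_order all_algebra finmap.
From mathcomp Require Import complex.
From mathcomp Require Import all_classical all_reals all_analysis.
From mathcomp Require Import ring lra zify.

Set Implicit Arguments.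
Unset Strict Implicit.
Unset Printing Implicit Defensive.

Import Order.TTheory GRing.Theory Num.Theory.
Import numFieldNormedType.Exports.

Local Open Scope classical_set_scope.
Local Open Scope ring_scope.

(** The even- and the odd-indexed points of Lambda each have upper density less
    than 1 / beta. If u and v in V^oo vanish exactly on the even and on the odd
    points respectively, within Lambda, then f = u + v and g = u - v satisfy
    f^2 - g^2 = 4 u v = 0 on Lambda, and they are independent since v does not
    vanish at the zeros of u and conversely.

    To construct u, put z = exp (2 gamma beta x) and q = exp (- gamma beta^2):
    sum_k c_k exp (- gamma (x - beta k)^2) is exp (- gamma x^2) times the Laurent
    series sum_k c_k q^(k^2) z^k. The product
      prod_(j >= 0) (1 - s_j z) (1 - t_j / z),
    with 1 / s_j the images of the nonnegative zeros and t_j those of the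
    negative ones, has the required zeros. The density bound gives
    s_j, t_j <= A (q^2 tau)^j with tau < 1, as for a theta product with nome
    smaller than q, whence its coefficients are O(q^(k^2)) and c is bounded. *)

#[local] Existing Instance totally_filter.

(** * Dominated convergence for series over the integers *)

Lemma geometric_tail_le (R : realFieldType) (r : R) (k n : nat) :
  0 <= r -> r < 1 -> \sum_(m < n | (k <= m)%N) r ^+ m <= r ^+ k / (1 - r).
Proof.
move=> r0 r1; rewrite ler_pdivlMr ?subr_gt0//.
suff : (\sum_(m < n | (k <= m)%N) r ^+ m) * (1 - r) =
    if (k <= n)%N then r ^+ k - r ^+ n else 0.
  by move=> ->; case: ifP => _; rewrite ?gerBl exprn_ge0.
elim: n => [|n IH].
  by rewrite big_ord0 mul0r leqn0; case: eqP => // ->; rewrite subrr.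
rewrite big_mkcond/= big_ord_recr/= -big_mkcond/= mulrDl IH.
have [kn|kn|->] := ltngtP k n.
- by rewrite (leqW (ltnW kn)) exprS; ring.
- rewrite mul0r addr0; case: ifP => // kn1.
  have -> : k = n.+1 by apply/eqP; rewrite eqn_leq kn1.
  by rewrite subrr.
- by rewrite leqnSn exprS; ring.
Qed.

(** Grouping the terms by absolute value, each natural [i] is reached by at most two integers, [i]
    and [- i]. *)
Lemma sum_absz_le (R : realFieldType) (w : nat -> R) (C : R) (B : seq int) :
  (forall i, 0 <= w i) -> (forall n, \sum_(i < n) w i <= C) -> uniq B ->
  \sum_(k <- B) w `|k|%N <= 2 * C.
Proof.
move=> w0 wC uB; pose n := (\max_(k <- B) `|k|%N).+1.
have -> : \sum_(k <- B) w `|k|%N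
    = \sum_(k <- B) \sum_(i < n | i == `|k|%N :> nat) w i.
  rewrite big_seq [RHS]big_seq; apply: eq_bigr => k kB.
  have kn : (`|k| < n)%N by rewrite ltnS; apply: leq_bigmax_seq.
  by rewrite (big_pred1 (Ordinal kn)).
under eq_bigr do rewrite big_mkcond.
rewrite exchange_big/=.
apply: (@le_trans _ _ (\sum_(i < n) 2 * w i)); last first.
  by rewrite -mulr_sumr ler_pM2l.
apply: ler_sum => i _.
rewrite -big_mkcond big_const_seq iter_addr_0 -[leLHS]mulr_natl ler_wpM2r ?w0// ler_nat.
rewrite -size_filter -(_ : size [:: i%:Z; - i%:Z] = 2)%N//.
apply: uniq_leq_size; first exact: filter_uniq.
by move=> k; rewrite mem_filter !inE => /andP[/eqP ik _]; lia.
Qed.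

(** The set [A] depends on [K] and [e] only, so it serves a whole dominated family at once.
    Splitting 4^-|k| = 2^-|k| 2^-|k|, one factor is at most 2^-N off [A] and the other sums to at
    most 4 over the integers. *)
Lemma dominated_sum_tail (R : realType) (K e : R) : 0 <= K -> 0 < e ->
  exists A : {fset int}, forall u : int -> R,
    (forall k, `|u k| <= K * 4^-1 ^+ `|k|%N) ->
    forall B : {fset int}, (A `<=` B)%fset ->
    `|\sum_(k <- B) u k - \sum_(k <- A) u k| <= e.
Proof.
move=> K0 e0.
have [N HN] : exists N : nat, 4 * K / e <= N%:R.
  exists (Num.bound (4 * K / e)); apply/ltW/archi_boundP.
  by rewrite divr_ge0 ?mulr_ge0 // ltW.
(* Since [Negz i] is -(i + 1), this is the interval from -N to N - 1. *)
pose A := ([fset k in [seq Posz i | i <- iota 0 N] ++ [seq Negz i | i <- iota 0 N]])%fset.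
exists A => u Hu B AB.
have AN k : k \notin A -> (N <= `|k|)%N.
  rewrite !inE/= negb_or => /andP[].
  case: k => k /=.
    move=> + _; apply: contraR; rewrite -ltnNge => kN.
    by apply: map_f; rewrite mem_iota.
  move=> _; apply: contraR; rewrite -ltnNge => kN.
  by apply: map_f; rewrite mem_iota; lia.
have -> : \sum_(k <- B) u k - \sum_(k <- A) u k = \sum_(k <- B | k \notin A) u k.
  rewrite (bigID (mem A))/= [X in X + _ - _](_ : _ = \sum_(k <- A) u k).
    by rewrite addrAC subrr add0r.
  rewrite -big_filter; apply: perm_big; apply: uniq_perm; [| exact: fset_uniq |].
    by rewrite filter_uniq ?fset_uniq.
  by move=> k; rewrite mem_filter; apply: andb_idr => /(fsubsetP AB).
apply: le_trans (ler_norm_sum _ _ _) _.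
have p2 : (0 : R) < 2^-1 ^+ N by rewrite exprn_gt0// invr_gt0.
apply: (@le_trans _ _ (\sum_(k <- B | k \notin A) K * 2^-1 ^+ N * 2^-1 ^+ `|k|%N)).
  apply: ler_sum => k /AN Nk; apply: le_trans (Hu _) _.
  rewrite -mulrA ler_wpM2l// [4^-1](_ : _ = 2^-1 * 2^-1 :> R); last by field.
  rewrite exprMn ler_wpM2r ?exprn_ge0 ?invr_ge0//.
  by rewrite ler_wiXn2l// ?invr_ge0 ?invf_le1 ?ler1n.
rewrite -mulr_sumr -big_filter.
apply: (@le_trans _ _ (K * 2^-1 ^+ N * (2 * 2))).
  rewrite ler_wpM2l ?(mulr_ge0 K0 (ltW p2))//.
  apply: (@sum_absz_le R (fun i => 2^-1 ^+ i) 2).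
  - by move=> i; rewrite exprn_ge0 ?invr_ge0.
  - move=> n; have := @geometric_tail_le R 2^-1 0 n.
    rewrite (_ : (1 - 2^-1) = 2^-1) ?expr0 ?mul1r ?invrK; last by field.
    by apply; rewrite ?invr_ge0 ?invf_lt1 ?ltr1n.
  - by rewrite filter_uniq ?fset_uniq.
have N2 : (N%:R : R) <= 2 ^+ N by rewrite -natrX ler_nat ltnW// ltn_expl.
rewrite exprVn -mulrA (mulrC _ (2 * 2)) mulrA ler_pdivrMr ?exprn_gt0//.
rewrite ler_pdivrMr// in HN; nra.
Qed.

(** Tannery's theorem: one finite set approximates all the sums within e / 4, and on a finite set
    the limit in [n] passes through the sum. *)
Lemma tannery_int (R : realType) (K : R) (u : nat -> int -> R) (v : int -> R)
    (G : nat -> R) :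
  (forall n k, `|u n k| <= K * 4^-1 ^+ `|k|%N) ->
  (forall k, u ^~ k @ \oo --> v k) ->
  (forall n, exists A : {fset int}, forall B : {fset int}, (A `<=` B)%fset ->
     \sum_(k <- B) u n k = G n) ->
  exists2 l : R, partial_sum v @ totally --> l & G @ \oo --> l.
Proof.
move=> uK uv uG.
have K0 : 0 <= K.
  by have := le_trans (normr_ge0 _) (uK 0%N 0); rewrite expr0 mulr1.
have vK k : `|v k| <= K * 4^-1 ^+ `|k|%N.
  by apply: cvgr_to_le (cvg_norm (uv k)) _; apply: nearW => n; exact: uK.
have K1 e : 0 < e -> exists A : {fset int}, forall B, (A `<=` B)%fset ->
    `|\sum_(k <- B) v k - \sum_(k <- A) v k| <= e /\
    forall n, `|\sum_(k <- B) u n k - \sum_(k <- A) u n k| <= e.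
  move=> e0; have [A HA] := dominated_sum_tail K0 e0.
  by exists A => B AB; split => [|n]; apply: HA.
have psE (B : {fset int}) : partial_sum v B = \sum_(k <- B) v k.
  by rewrite /partial_sum big_seq_fsetE.
have cv : cvg (partial_sum v @ totally).
  apply/cauchy_cvgP/cauchy_exP => e e0.
  have [A HA] := K1 _ (divr_gt0 e0 (ltr0n R 2)).
  exists (\sum_(k <- A) v k); exists A => // B AB /=.
  rewrite -ball_normE/= psE distrC.
  by apply: le_lt_trans (HA B AB).1 _; rewrite ltr_pdivrMr// ltr_pMr// ltr1n.
exists (lim (partial_sum v @ totally)) => //; set l := lim _.
apply/cvgrPdist_le => e e0.
have e4 : 0 < e / 4 by rewrite divr_gt0.
have [A HA] := K1 _ e4.
have lA : `|l - \sum_(k <- A) v k| <= e / 4.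
  rewrite distrC; apply: cvgr_to_le (cvg_norm (cvgB (cvg_cst _) cv)) _.
  by exists A => // B AB; have := (HA B AB).1; rewrite -(psE B) distrC.
have uA : (fun n => \sum_(k <- A) u n k) @ \oo --> \sum_(k <- A) v k.
  by apply: cvg_big => [|k _]; [exact: add_continuous | exact: uv].
near=> n.
have [A' HA'] := uG n.
(* The union is large enough both for the sum of [u n] to equal [G n] and for the uniform tail
   estimate. *)
rewrite -(HA' (A `|` A')%fset) ?fsubsetUr//.
have := (HA (A `|` A')%fset (fsubsetUl _ _)).2 n.
have : `|\sum_(k <- A) v k - \sum_(k <- A) u n k| <= e / 4.
  by near: n; move/cvgrPdist_le : uA => /(_ _ e4).
move: lA; rewrite !ler_norml; lra.
Unshelve. all: by end_near. Qed.

(** * Laurent coefficients of the finite products *)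

Lemma geometric_eventually_le (R : realType) (K r e : R) :
  0 <= r -> r < 1 -> 0 < e -> exists N, K * r ^+ N <= e.
Proof.
move=> r0 r1 e0.
have /cvgrPdist_le/(_ _ e0)[N _ /(_ N (leqnn N))] : geometric K r @ \oo --> (0 : R).
  by apply: cvg_geometric; rewrite ger0_norm.
by rewrite /= sub0r normrN => /(le_trans (ler_norm _)); exists N.
Qed.

(** From an index N with |K| r^N <= 1 on, [d] no longer increases, so the sum of its first N + 1
    terms is a bound. *)
Lemma ratio_bounded (R : realType) (K r : R) (d : nat -> R) :
  0 <= r -> r < 1 -> (forall k, 0 <= d k) ->
  (forall k, d k.+1 <= K * r ^+ k * d k) -> exists C, forall k, d k <= C.
Proof.
move=> r0 r1 d0 dS.
have [N HN] : exists N, `|K| * r ^+ N <= 1 by exact: geometric_eventually_le.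
exists (\sum_(j < N.+1) d j); elim=> [|k IH].
  by rewrite big_ord_recl /= lerDl sumr_ge0.
have [kN|Nk] := leqP k.+1 N.
  rewrite (bigD1 (Ordinal (kN : (k.+1 < N.+1)%N)))//= lerDl.
  by rewrite sumr_ge0.
apply: le_trans IH; apply: le_trans (dS k) _.
rewrite -[leRHS]mul1r ler_wpM2r//; apply: le_trans HN.
apply: (@le_trans _ _ (`|K| * r ^+ k)).
  by rewrite ler_wpM2r ?exprn_ge0// ler_norm.
by rewrite ler_wpM2l// ler_wiXn2l// ltW.
Qed.

Section product.
Variables (R : realType).
Implicit Types (s t : nat -> R) (n k : nat).

(** The plus sign keeps the coefficients nonnegative and nondecreasing in [n]; the factors 1 - s_j z
    are recovered by evaluating at -z. *)
Definition zeros_poly s n : {poly R} := \prod_(j < n) (1 + s j *: 'X).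

Lemma horner_zeros_poly s n x :
  (zeros_poly s n).[x] = \prod_(j < n) (1 + s j * x).
Proof.
rewrite horner_prod; apply: eq_bigr => j _.
by rewrite hornerD hornerZ hornerX hornerC.
Qed.

Lemma zeros_polyS s n :
  zeros_poly s n.+1 = zeros_poly s n + s n *: (zeros_poly s n * 'X).
Proof.
by rewrite /zeros_poly big_ord_recr/= mulrDr mulr1 scalerAr.
Qed.

Lemma size_zeros_poly s n : (size (zeros_poly s n) <= n.+1)%N.
Proof.
elim: n => [|n IH]; first by rewrite /zeros_poly big_ord0 size_poly1.
rewrite zeros_polyS; apply: leq_trans (size_polyD _ _) _.
rewrite geq_max (leqW IH) /=; apply: leq_trans (size_scale_leq _ _) _.
apply: leq_trans (size_polyMleq _ _) _.
by rewrite size_polyX addn2.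
Qed.

Lemma coef0_zeros_poly s n : (zeros_poly s n)`_0 = 1.
Proof.
elim: n => [|n IH]; first by rewrite /zeros_poly big_ord0 coef1.
by rewrite zeros_polyS coefD coefZ coefMX IH /= mulr0 addr0.
Qed.

Lemma coefS_zeros_poly s n k : (zeros_poly s n.+1)`_k.+1 =
  (zeros_poly s n)`_k.+1 + s n * (zeros_poly s n)`_k.
Proof. by rewrite zeros_polyS coefD coefZ coefMX. Qed.

Lemma coef_zeros_poly_ge0 s n k :
  (forall j, 0 <= s j) -> 0 <= (zeros_poly s n)`_k.
Proof.
move=> s0; elim: n k => [|n IH] [|k]; rewrite ?coef0_zeros_poly//.
  by rewrite /zeros_poly big_ord0 coef1.
by rewrite coefS_zeros_poly addr_ge0 ?mulr_ge0.
Qed.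

Lemma coef_zeros_poly_nondecreasing s n k : (forall j, 0 <= s j) ->
  (zeros_poly s n)`_k <= (zeros_poly s n.+1)`_k.
Proof.
move=> s0; case: k => [|k]; first by rewrite !coef0_zeros_poly.
by rewrite coefS_zeros_poly lerDl mulr_ge0 ?coef_zeros_poly_ge0.
Qed.

(** Induction on [k]: sorting the monomials of degree k + 1 by their largest index m leaves s_m
    times a coefficient of degree k, which vanishes for m < k. The remaining geometric tail
    contributes r^k / (1 - r). *)
Lemma coef_zeros_poly_le_prod s (A r : R) n k :
  0 <= r -> r < 1 -> (forall j, 0 <= s j <= A * r ^+ j) ->
  (zeros_poly s n)`_k <= \prod_(i < k) (A / (1 - r) * r ^+ i).
Proof.
move=> r0 r1 sA.
have s0 j : 0 <= s j by case/andP : (sA j).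
have A0 : 0 <= A.
  by have /andP[h] := sA 0%N; rewrite expr0 mulr1; apply: le_trans.
elim: k n => [|k IH] n; first by rewrite coef0_zeros_poly big_ord0.
have -> : (zeros_poly s n)`_k.+1 =
    \sum_(m < n | (k <= m)%N) s m * (zeros_poly s m)`_k.
  elim: n => [|n IHn]; first by rewrite big_ord0 /zeros_poly big_ord0 coef1.
  rewrite coefS_zeros_poly IHn [RHS]big_mkcond/= big_ord_recr/= -big_mkcond/=.
  congr (_ + _); case: ifPn => //; rewrite -ltnNge => nk.
  by rewrite [X in _ * X]nth_default ?mulr0// (leq_trans (size_zeros_poly s n)).
set c := \prod_(i < k) _ in IH *.
have c0 : 0 <= c by apply: le_trans (IH 0%N); rewrite coef_zeros_poly_ge0.
apply: (@le_trans _ _ (\sum_(m < n | (k <= m)%N) A * c * r ^+ m)).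
  apply: ler_sum => m _; rewrite mulrAC ler_pM ?coef_zeros_poly_ge0//.
  by case/andP : (sA m).
rewrite -mulr_sumr big_ord_recr/= -/c.
rewrite [leRHS](_ : _ = A * c * (r ^+ k / (1 - r))); last by ring.
by rewrite ler_wpM2l ?mulr_ge0//; exact: geometric_tail_le.
Qed.

(** The product bound contains r^(k(k-1)/2) = q^(k^2-k) tau^(k(k-1)/2). Its quotient by the weight
    on the right has successive ratios of the form const * tau^k, so the powers of tau absorb every
    geometric factor. *)
Lemma coef_zeros_poly_le s (A q tau : R) :
  0 < q -> 0 <= tau -> tau < 1 -> q < 1 ->
  (forall j, 0 <= s j <= A * (q ^+ 2 * tau) ^+ j) ->
  exists C, forall n k,
    (zeros_poly s n)`_k <= C * (q ^+ (k ^ 2) * 2^-1 ^+ k).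
Proof.
move=> q0 tau0 tau1 q1 sA.
set r := q ^+ 2 * tau in sA.
have r0 : 0 <= r by rewrite mulr_ge0 ?exprn_ge0// ltW.
have r1 : r < 1 by rewrite (le_lt_trans _ tau1)// ler_piMl// exprn_ile1// ltW.
pose c k := \prod_(i < k) (A / (1 - r) * r ^+ i).
have wgt0 k : 0 < q ^+ (k ^ 2) * 2^-1 ^+ k.
  by rewrite mulr_gt0 ?exprn_gt0 ?invr_gt0.
have c0 k : 0 <= c k.
  apply: le_trans (coef_zeros_poly_le_prod 0 k r0 r1 sA).
  by apply: coef_zeros_poly_ge0 => j; case/andP : (sA j).
have [||C HC] := @ratio_bounded R (A / (1 - r) * 2 / q) tau
    (fun k => c k / (q ^+ (k ^ 2) * 2^-1 ^+ k)) tau0 tau1.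
- by move=> k; rewrite divr_ge0// ltW.
- move=> k; rewrite /c big_ord_recr/= -/(c k).
  rewrite (_ : (k.+1 ^ 2 = k ^ 2 + k * 2 + 1)%N); last by lia.
  rewrite !exprD expr1 (exprS _ k) /r exprMn -(exprM q 2) (mulnC 2%N).
  rewrite le_eqVlt; apply/orP; left; apply/eqP.
  field.
  by rewrite ?expf_neq0 ?gt_eqF// subr_gt0.
exists C => n k; rewrite -ler_pdivrMr//; apply: le_trans (HC k).
by rewrite ler_pM2r ?invr_gt0//; apply: coef_zeros_poly_le_prod.
Qed.

(** The coefficient of z^k in P(z) Q(1/z), with P and Q the polynomials of [s] and [t], both of
    degree at most [n]. *)
Definition laurent_coef s t n (k : int) : R :=
  \sum_(i < n.+1) \sum_(m < n.+1 | i%:Z - m%:Z == k)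
    (zeros_poly s n)`_i * (zeros_poly t n)`_m.

Lemma laurent_coef_ge0 s t n (k : int) :
  (forall j, 0 <= s j) -> (forall j, 0 <= t j) ->
  0 <= laurent_coef s t n k.
Proof.
move=> s0 t0; apply: sumr_ge0 => i _; apply: sumr_ge0 => m _.
by rewrite mulr_ge0 ?coef_zeros_poly_ge0.
Qed.

Lemma laurent_coef_nondecreasing s t (k : int) :
  (forall j, 0 <= s j) -> (forall j, 0 <= t j) ->
  {homo (fun n => laurent_coef s t n k) : n m / (n <= m)%N >-> n <= m}.
Proof.
move=> s0 t0; apply/nondecreasing_seqP => n; rewrite /laurent_coef.
have pq0 (i m : nat) : 0 <= (zeros_poly s n.+1)`_i * (zeros_poly t n.+1)`_m.
  by rewrite mulr_ge0 ?coef_zeros_poly_ge0.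
rewrite [leRHS]big_ord_recr /= -[leLHS]addr0 lerD ?sumr_ge0//.
apply: ler_sum => i _.
rewrite [leRHS]big_mkcond big_ord_recr /= -big_mkcond /= -[leLHS]addr0 lerD//; last first.
  by case: ifP.
apply: ler_sum => m _.
by rewrite ler_pM ?coef_zeros_poly_ge0 ?coef_zeros_poly_nondecreasing.
Qed.

(* The weight 2^-k leaves room to sum over all pairs (i, m), not only those
   with i - m = k. *)
Lemma laurent_coef_le s t (A q tau : R) :
  0 < q -> 0 <= tau -> tau < 1 -> q < 1 ->
  (forall j, 0 <= s j <= A * (q ^+ 2 * tau) ^+ j) ->
  (forall j, 0 <= t j <= A * (q ^+ 2 * tau) ^+ j) ->
  exists C, forall n (k : int), laurent_coef s t n k <= C * q ^+ (`|k| ^ 2).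
Proof.
move=> q0 tau0 tau1 q1 sA tA.
have [C HC] := coef_zeros_poly_le q0 tau0 tau1 q1 sA.
have [D HD] := coef_zeros_poly_le q0 tau0 tau1 q1 tA.
have s0 j : 0 <= s j by case/andP : (sA j).
have t0 j : 0 <= t j by case/andP : (tA j).
have half0 j : (0 : R) <= 2^-1 ^+ j by rewrite exprn_ge0 ?invr_ge0.
have C0 : 0 <= C.
  by have := HC 0%N 0%N; rewrite coef0_zeros_poly expr0 !mulr1; apply: le_trans.
have D0 : 0 <= D.
  by have := HD 0%N 0%N; rewrite coef0_zeros_poly expr0 !mulr1; apply: le_trans.
exists (C * D * 4) => n k.
apply: (@le_trans _ _ (\sum_(i < n.+1) \sum_(m < n.+1)
    C * D * q ^+ (`|k| ^ 2) * (2^-1 ^+ i * 2^-1 ^+ m))).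
  apply: ler_sum => i _; rewrite big_mkcond; apply: ler_sum => m _.
  case: ifPn => [/eqP kE|_]; last first.
    by rewrite !mulr_ge0 ?half0// exprn_ge0// ltW.
  apply: (@le_trans _ _ ((C * (q ^+ (i ^ 2) * 2^-1 ^+ i)) *
                         (D * (q ^+ (m ^ 2) * 2^-1 ^+ m)))).
    by rewrite ler_pM ?coef_zeros_poly_ge0.
  rewrite [leLHS](_ : _ = C * D * q ^+ (i ^ 2 + m ^ 2) * (2^-1 ^+ i * 2^-1 ^+ m)).
    rewrite ler_wpM2r ?mulr_ge0 ?half0// ler_wpM2l ?mulr_ge0//.
    (* As q < 1, it remains to see that (i - m)^2 <= i^2 + m^2, which holds for i, m >= 0. *)
    rewrite ler_wiXn2l ?(ltW q0) ?(ltW q1)//.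
    by rewrite -kE; nia.
  by rewrite exprD; ring.
under eq_bigr do rewrite -mulr_sumr -mulr_sumr.
rewrite -mulr_sumr -mulr_suml.
have h2 : \sum_(i < n.+1) (2^-1 : R) ^+ i <= 2.
  have := @geometric_tail_le R 2^-1 0 n.+1.
  rewrite (_ : (1 - 2^-1) = 2^-1) ?expr0 ?mul1r ?invrK; last by field.
  by apply; rewrite ?invr_ge0 ?invf_lt1 ?ltr1n.
rewrite [leRHS](_ : _ = C * D * q ^+ (`|k| ^ 2) * (2 * 2)); last by ring.
rewrite ler_wpM2l ?mulr_ge0 ?exprn_ge0 ?(ltW q0)//.
by apply: ler_pM => //; apply: sumr_ge0 => i _.
Qed.

Lemma sum_laurent_coef s t n z : z != 0 ->
  exists A : {fset int}, forall B : {fset int}, (A `<=` B)%fset ->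
  \sum_(k <- B) laurent_coef s t n k * z ^ k =
  (zeros_poly s n).[z] * (zeros_poly t n).[z^-1].
Proof.
move=> z0.
exists [fset k in [seq i%:Z - m%:Z | i <- iota 0 n.+1, m <- iota 0 n.+1]]%fset.
move=> B AB; rewrite (horner_coef_wide _ (size_zeros_poly s n)).
rewrite (horner_coef_wide _ (size_zeros_poly t n)) mulr_suml.
under eq_bigr do rewrite mulr_suml.
rewrite exchange_big; apply: eq_bigr => i _ /=.
under eq_bigr do rewrite big_mkcond mulr_suml.
rewrite exchange_big mulr_sumr; apply: eq_bigr => m _ /=.
have imB : i%:Z - m%:Z \in B.
  apply: (fsubsetP AB); apply/imfsetP.
  exists (i%:Z - m%:Z) => //; apply: (@allpairs_f _ _ _ (fun i m : nat => i%:Z - m%:Z)).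
    by rewrite mem_iota add0n ltn_ord.
  by rewrite mem_iota add0n ltn_ord.
rewrite (big_fsetD1 (i%:Z - m%:Z))//= eqxx big_seq big1 ?addr0.
  by rewrite expfzDr// -exprz_inv -!exprnP; ring.
move=> k; rewrite !inE => /andP[ki _]; rewrite eq_sym (negbTE ki) mul0r//.
Qed.

End product.

(** * The infinite product *)

Lemma sign_exprz_norm (R : realFieldType) (k : int) : `|(-1 : R) ^ k| = 1.
Proof.
by case: k => n; rewrite ?NegzE -?exprnP -?exprnN ?normfV normrX normrN1 expr1n ?invr1.
Qed.

(** With y = z + 1/z one has z^k <= y^|k| for either sign of k, and q^(k^2) outweighs (4 y)^k. *)
Lemma gaussian_weight_bound (R : realType) (q z : R) :
  0 < q -> q < 1 -> 0 < z ->
  exists C, forall k : int, q ^+ (`|k| ^ 2) * z ^ k <= C * 4^-1 ^+ `|k|%N.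
Proof.
move=> q0 q1 z0; pose y := z + z^-1.
have zi0 : 0 < z^-1 by rewrite invr_gt0.
have y0 : 0 < y by rewrite addr_gt0.
have zy k : z ^ k <= y ^+ `|k|%N.
  case: k => n.
    by rewrite -exprnP lerXn2r ?nnegrE ?(ltW y0) ?(ltW z0)// lerDl ltW.
  rewrite NegzE -exprz_inv abszN /= -exprnP.
  by rewrite lerXn2r ?nnegrE ?(ltW y0) ?(ltW zi0)// lerDr ltW.
have [||||C HC] := @ratio_bounded R (4 * y * q) (q ^+ 2)
    (fun k => q ^+ (k ^ 2) * y ^+ k * 4 ^+ k).
- by rewrite exprn_ge0// ltW.
- by rewrite exprn_ilt1// ltW.
- by move=> k; rewrite !mulr_ge0 ?exprn_ge0// ltW.
- move=> k; rewrite (_ : (k.+1 ^ 2 = k ^ 2 + 2 * k + 1)%N); last by lia.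
  rewrite (exprD q (k ^ 2 + 2 * k)) (exprD q (k ^ 2)) expr1 !(exprS _ k).
  by rewrite (exprM q 2) le_eqVlt; apply/orP; left; apply/eqP; ring.
exists C => k; rewrite exprVn ler_pdivlMr ?exprn_gt0//.
apply: le_trans (HC `|k|%N).
by rewrite ler_pM2r ?exprn_gt0// ler_pM2l ?exprn_gt0.
Qed.

(** The coefficients of the finite products increase with [n] and are O(q^(k^2)), so they converge;
    dividing the limits by q^(k^2) gives a bounded [c]. Tannery's theorem then identifies the
    Laurent series with the limit of the products. *)
Lemma laurent_product_cvg (R : realType) (s t : nat -> R) (A q tau : R) :
  0 < q -> 0 <= tau -> tau < 1 -> q < 1 ->
  (forall j, 0 <= s j <= A * (q ^+ 2 * tau) ^+ j) ->
  (forall j, 0 <= t j <= A * (q ^+ 2 * tau) ^+ j) ->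
  exists2 c : int -> R, exists M, forall k, `|c k| <= M &
    forall z, 0 < z -> exists2 l : R,
      partial_sum (fun k : int => c k * (q ^+ (`|k| ^ 2) * z ^ k))
        @ totally --> l &
      (fun n => \prod_(j < n) (1 - s j * z) * \prod_(j < n) (1 - t j / z))
        @ \oo --> l.
Proof.
move=> q0 tau0 tau1 q1 sA tA.
have s0 j : 0 <= s j by case/andP : (sA j).
have t0 j : 0 <= t j by case/andP : (tA j).
have [C HC] := laurent_coef_le q0 tau0 tau1 q1 sA tA.
have qk0 k : 0 < q ^+ (`|k : int| ^ 2) by rewrite exprn_gt0.
have cb k : cvgn (fun n => laurent_coef s t n k).
  apply: nondecreasing_is_cvgn.
    by move=> n m nm; apply: laurent_coef_nondecreasing.
  by exists (C * q ^+ (`|k| ^ 2)) => _ [n _ <-].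
pose b k := limn (fun n => laurent_coef s t n k).
have b0 k : 0 <= b k.
  by apply: limr_ge => //; apply: nearW => n; exact: laurent_coef_ge0.
have bC k : b k <= C * q ^+ (`|k| ^ 2).
  by apply: limr_le => //; apply: nearW => n; exact: HC.
(* The sign comes from evaluation at -z. *)
exists (fun k => (-1) ^ k * (b k / q ^+ (`|k| ^ 2))).
  exists C => k; rewrite normrM sign_exprz_norm mul1r ger0_norm.
    by rewrite ler_pdivrMr.
  by rewrite divr_ge0// ltW.
move=> z z0; have [D HD] := gaussian_weight_bound q0 q1 z0.
have C0 : 0 <= C by have := bC 0; rewrite expr0 mulr1; apply: le_trans.
have zk0 k : 0 <= z ^ k by rewrite exprz_ge0// ltW.
have Nzk k : (- z) ^ k = (-1) ^ k * z ^ k.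
  by rewrite -exprzMl ?mulN1r// ?unitrN1 ?unitfE ?gt_eqF.
have [|||l vl Gl] := @tannery_int R (C * D)
    (fun n k => laurent_coef s t n k * (- z) ^ k)
    (fun k => b k * (- z) ^ k)
    (fun n => (zeros_poly s n).[- z] * (zeros_poly t n).[(- z)^-1]).
- move=> n k; rewrite Nzk !normrM sign_exprz_norm mul1r !ger0_norm ?laurent_coef_ge0//.
  apply: (@le_trans _ _ (C * (q ^+ (`|k| ^ 2) * z ^ k))).
    by rewrite mulrA ler_wpM2r.
  by rewrite -mulrA ler_wpM2l.
- by move=> k; apply: cvgMr_tmp; exact: cb.
- by move=> n; apply: sum_laurent_coef; rewrite oppr_eq0 gt_eqF.
exists l.
  rewrite (_ : (fun k : int => _) = fun k => b k * (- z) ^ k)//.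
  by apply/funext => k; rewrite Nzk; field; rewrite expf_neq0 ?gt_eqF.
rewrite (_ : (fun n => _) =
  fun n => (zeros_poly s n).[- z] * (zeros_poly t n).[(- z)^-1])//.
apply/funext => n; rewrite !horner_zeros_poly.
by congr (_ * _); apply: eq_bigr => j _; rewrite ?invrN mulrN.
Qed.

(** This keeps the infinite product away from 0 off its zeros. The first N factors are nonzero; the
    later x_j sum to at most 1/2, and the product of the 1 - x_j is at least 1 minus their sum. *)
Lemma prod_1sub_lower_bound (R : realType) (x : nat -> R) (A r : R) :
  0 <= r -> r < 1 -> (forall j, 0 <= x j <= A * r ^+ j) -> (forall j, x j != 1) ->
  exists2 e, 0 < e & \forall n \near \oo, e <= `|\prod_(j < n) (1 - x j)|.
Proof.
move=> r0 r1 xA x1.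
have x0 j : 0 <= x j by case/andP : (xA j).
have [N HN] : exists N, A / (1 - r) * r ^+ N <= 2^-1.
  by apply: geometric_eventually_le; rewrite ?invr_gt0.
have tail n : \sum_(j < n) x (N + j)%N <= 2^-1.
  apply: le_trans HN; apply: (@le_trans _ _ (\sum_(j < n) A * r ^+ N * r ^+ j)).
    by apply: ler_sum => j _; rewrite -mulrA -exprD; case/andP : (xA (N + j)%N).
  rewrite -mulr_sumr [leRHS](_ : _ = A * r ^+ N * (r ^+ 0 / (1 - r))); last first.
    by rewrite expr0; ring.
  rewrite ler_wpM2l//; first by apply: le_trans (x0 N) _; case/andP : (xA N).
  exact: (geometric_tail_le 0 n r0 r1).
pose p := `|\prod_(j < N) (1 - x j)|.
have p0 : 0 < p.
  rewrite normr_gt0; apply/prodf_neq0 => j _.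
  by rewrite subr_eq0 eq_sym.
exists (p / 2); first by rewrite divr_gt0.
have Hp n : p * (1 - \sum_(j < n) x (N + j)%N) <= `|\prod_(j < N + n) (1 - x j)|.
  elim: n => [|n IH]; first by rewrite addn0 big_ord0 subr0 mulr1.
  rewrite addnS !big_ord_recr /= normrM.
  have h := tail n; have h1 := tail n.+1; rewrite big_ord_recr/= in h1.
  have xn := x0 (N + n)%N.
  have S0 : 0 <= \sum_(j < n) x (N + j)%N by apply: sumr_ge0.
  rewrite (ger0_norm (_ : 0 <= 1 - x (N + n)%N)); last by lra.
  apply: (@le_trans _ _ (p * (1 - \sum_(j < n) x (N + j)%N) * (1 - x (N + n)%N))).
    rewrite -mulrA ler_wpM2l ?(ltW p0)//; nra.
  by rewrite ler_wpM2r//; lra.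
exists N => // n /= Nn; rewrite -(subnKC Nn); apply: le_trans (Hp _).
by rewrite ler_wpM2l ?(ltW p0)//; have := tail (n - N)%N; lra.
Qed.

(** * Prescribed zeros in the Gaussian shift-invariant space *)

Lemma expRM_intl (R : realType) (k : int) (x : R) :
  expR (k%:~R * x) = expR x ^ k.
Proof.
case: k => n; first by rewrite -pmulrn expRM_natl.
by rewrite NegzE mulrNz mulNr expRN -pmulrn expRM_natl.
Qed.

Lemma gaussian_shift (R : realType) (beta gamma x : R) (k : int) :
  gaussian gamma (x - beta * k%:~R) = gaussian gamma x *
    (gaussian gamma beta ^+ (`|k| ^ 2) * expR (2 * gamma * beta * x) ^ k).
Proof.
rewrite /gaussian -expRM_natl -expRM_intl -!expRD; congr expR.
have -> : (`|k| ^ 2)%:R = k%:~R ^+ 2 :> R.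
  by rewrite natrX natr_absz intr_norm real_normK ?num_real.
ring.
Qed.

Lemma gaussian_series_prescribed_zeros (R : realType) (beta gamma c C : R)
    (mu nu : nat -> R) :
  0 < beta -> 0 < gamma -> beta < c ->
  (forall j, c * j%:R - C <= mu j) -> (forall j, nu j <= C - c * j%:R) ->
  exists a : int -> R, exists h : R -> R,
  [/\ exists M, forall k, `|a k| <= M,
      forall x, partial_sum
          (fun k : int => a k * gaussian gamma (x - beta * k%:~R))
        @ totally --> h x,
      forall j, h (mu j) = 0 /\ h (nu j) = 0 &
      forall x, (forall j, x != mu j /\ x != nu j) -> h x != 0].
Proof.
move=> beta0 gamma0 betac muC nuC.
pose al := 2 * gamma * beta; pose q := gaussian gamma beta.
have al0 : 0 < al by rewrite !mulr_gt0.
have q0 : 0 < q by exact: expR_gt0.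
have q1 : q < 1 by rewrite expR_lt1 mulNr oppr_lt0 mulr_gt0 ?exprn_gt0.
(* Chosen so that q^2 tau = exp(- al c), the decay rate of [s] and [t] below; tau < 1 because beta <
   c. *)
pose tau := expR (- (al * (c - beta))).
have tau0 : 0 <= tau by exact: expR_ge0.
have tau1 : tau < 1 by rewrite expR_lt1 oppr_lt0 mulr_gt0 ?subr_gt0.
have q2tau : q ^+ 2 * tau = expR (- (al * c)).
  rewrite /q /tau /gaussian -expRM_natl -expRD; congr expR.
  by rewrite /al; ring.
pose s j := expR (- (al * mu j)); pose t j := expR (al * nu j).
have sA j : 0 <= s j <= expR (al * C) * (q ^+ 2 * tau) ^+ j.
  rewrite expR_ge0 q2tau -expRM_natl -expRD ler_expR.
  by have := muC j; rewrite -(ler_pM2l al0); lra.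
have tA j : 0 <= t j <= expR (al * C) * (q ^+ 2 * tau) ^+ j.
  rewrite expR_ge0 q2tau -expRM_natl -expRD ler_expR.
  by have := nuC j; rewrite -(ler_pM2l al0); lra.
have [a aM /= Ha] := laurent_product_cvg q0 tau0 tau1 q1 sA tA.
have sz j x : s j * expR (al * x) = expR (al * (x - mu j)).
  by rewrite -expRD; congr expR; ring.
have tz j x : t j / expR (al * x) = expR (al * (nu j - x)).
  by rewrite -expRN -expRD; congr expR; ring.
have /choice[l Hl] : forall x, exists l : R,
    partial_sum (fun k : int => a k * (q ^+ (`|k| ^ 2) * expR (al * x) ^ k))
      @ totally --> l /\
    (fun n => \prod_(j < n) (1 - s j * expR (al * x)) *
      \prod_(j < n) (1 - t j / expR (al * x))) @ \oo --> l.
  by move=> x; have [l ? ?] := Ha _ (expR_gt0 (al * x)); exists l.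
exists a, (fun x => gaussian gamma x * l x); split => //.
- move=> x; rewrite (_ : partial_sum _ = fun B => gaussian gamma x * partial_sum
    (fun k : int => a k * (q ^+ (`|k| ^ 2) * expR (al * x) ^ k)) B); last first.
    apply/funext => B; rewrite /partial_sum mulr_sumr; apply: eq_bigr => k _.
    by rewrite gaussian_shift mulrCA.
  by apply: cvgMl_tmp; exact: (Hl x).1.
(* One vanishing factor makes all later partial products, hence the limit, zero. *)
- have zero x (G := fun n => \prod_(j < n) (1 - s j * expR (al * x)) *
      \prod_(j < n) (1 - t j / expR (al * x))) :
      (exists N, forall n, (N < n)%N -> G n = 0) -> gaussian gamma x * l x = 0.
    move=> [N HN]; suff -> : l x = 0 by rewrite mulr0.
    apply: (cvg_unique (@Rhausdorff R) (Hl x).2).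
    apply: cvg_near_cst; exists N.+1 => // n /= Nn.
  move=> j; split; apply: zero; exists j => n jn.
    by rewrite (bigD1 (Ordinal jn))//= sz subrr mulr0 expR0 subrr !mul0r.
  by rewrite mulrC (bigD1 (Ordinal jn))//= tz subrr mulr0 expR0 subrr !mul0r.
move=> x xmn; apply: mulf_neq0; first by rewrite gt_eqF ?expR_gt0.
have expR_neq1 y : y != 0 -> expR (al * y) != 1 :> R.
  by move=> y0; rewrite -expR0 (inj_eq (@expR_inj R)) mulf_neq0 // gt_eqF.
have r0 : 0 <= q ^+ 2 * tau by rewrite q2tau expR_ge0.
have r1 : q ^+ 2 * tau < 1.
  by rewrite q2tau expR_lt1 oppr_lt0 mulr_gt0// (lt_trans beta0).
have [|j|e1 e10 He1] := @prod_1sub_lower_bound R (fun j => s j * expR (al * x))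
    (expR (al * C) * expR (al * x)) _ r0 r1.
- move=> j; have /andP[_ sj] := sA j.
  by rewrite mulr_ge0 ?expR_ge0//= [leRHS]mulrAC ler_pM2r ?expR_gt0.
- by rewrite sz expR_neq1// subr_eq0; exact: (xmn j).1.
have [|j|e2 e20 He2] := @prod_1sub_lower_bound R (fun j => t j / expR (al * x))
    (expR (al * C) / expR (al * x)) _ r0 r1.
- move=> j; have /andP[_ tj] := tA j.
  by rewrite divr_ge0 ?expR_ge0//= [leRHS]mulrAC ler_pM2r ?invr_gt0 ?expR_gt0.
- by rewrite tz expR_neq1// subr_eq0 eq_sym; exact: (xmn j).2.
suff : e1 * e2 <= `|l x|.
  by rewrite -normr_gt0; apply: lt_le_trans; rewrite mulr_gt0.
apply: cvgr_to_ge (cvg_norm (Hl x).2) _.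
by near=> n; rewrite normrM ler_pM ?(ltW e10) ?(ltW e20)//; near: n.
Unshelve. all: by end_near. Qed.

(** * Beurling density, gaps, and zeros at alternate points *)

Lemma upper_density_window (R : realType) (L : set R) (d : R) :
  (upper_beurling_density L < d%:E)%E ->
  exists2 r0 : R, 0 < r0 & forall r x (s : seq R), r0 <= r -> uniq s ->
    (forall y, y \in s -> L y /\ x - r <= y <= x + r) ->
    (size s)%:R <= d * (2 * r).
Proof.
move=> /ereal_inf_lt[_ [V [M [_ MV]] <-] Vd].
have r00 : 0 < Num.max M 0 + 1 by rewrite ltr_wpDl// le_max lexx orbT.
exists (Num.max M 0 + 1) => // r x s rr us sP.
have r0 : 0 < r by exact: lt_le_trans rr.
have Mr : M < r.
  by apply: lt_le_trans rr; rewrite ltr_pwDr// le_max lexx.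
have : (window_density L r x < d%:E)%E.
  apply: le_lt_trans Vd.
  apply: (@le_trans _ _ (ereal_sup (range (window_density L r)))).
    by apply: ereal_sup_ubound; exists x.
  by apply: ereal_sup_ubound; exists r => //; exact: MV.
have r20 : 0 < (2 * r)^-1 by rewrite invr_gt0 mulr_gt0.
(* An infinite window would have density +oo, which is not below [d]. *)
rewrite /window_density /counting; case: asboolP => [fX|_]; last first.
  by rewrite gt0_mulye ?lte_fin.
rewrite -EFinM lte_fin ltr_pdivrMr ?mulr_gt0// => /ltW; apply: le_trans.
rewrite ler_nat; apply: uniq_leq_size => // y /sP[Ly yr].
by rewrite in_fset_set// inE.
Qed.

(** The n + 1 points from index i to i + n lie in the window about their midpoint whose radius is
    half their spread plus [r0]; this padding makes the density estimate applicable and yields C = 2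
    r0. *)
Lemma increasing_gap_bound (R : realType) (lambda : int -> R) (d : R) :
  (forall i j : int, i < j -> lambda i < lambda j) ->
  (upper_beurling_density (range lambda) < d%:E)%E ->
  exists C, forall (i : int) (n : nat),
    n%:R <= d * (lambda (i + n%:Z) - lambda i + C).
Proof.
move=> incr /upper_density_window[r0 r00 H].
have homo i j : i <= j -> lambda i <= lambda j.
  by rewrite le_eqVlt => /predU1P[->//|/incr/ltW].
have inj : injective lambda.
  by move=> i j ij; have [/incr|/incr|//] := ltgtP i j; rewrite ij ltxx.
exists (2 * r0) => i n; set D := lambda (i + n%:Z) - lambda i.
have D0 : 0 <= D by rewrite subr_ge0 homo// lerDl.
have := H (D / 2 + r0) ((lambda i + lambda (i + n%:Z)) / 2)
  [seq lambda (i + m%:Z) | m <- iota 0 n.+1].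
rewrite size_map size_iota => H1.
apply: (@le_trans _ _ n.+1%:R); first by rewrite ler_nat.
rewrite [leRHS](_ : _ = d * (2 * (D / 2 + r0))); last by field.
apply: H1; first by rewrite lerDr divr_ge0.
  by rewrite map_inj_uniq ?iota_uniq// => m m' /inj/addrI[].
move=> y /mapP[m]; rewrite mem_iota add0n ltnS => /andP[_ mn] ->.
split; first by exists (i + m%:Z).
have := homo i (i + m%:Z); have := homo (i + m%:Z) (i + n%:Z).
rewrite lerDl lerD2l lez_nat mn => /(_ isT) h1 /(_ isT) h2.
by rewrite /D; lra.
Qed.

(** Advancing the index by 2j moves the point by at least 2j / d - C, so every second point
    progresses at rate c = 2 / d, which exceeds beta. *)
Lemma alternate_zeros (R : realType) (beta gamma d : R) (lambda : int -> R) :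
  0 < beta -> 0 < gamma -> 0 < d -> d < 2 / beta ->
  (forall i j : int, i < j -> lambda i < lambda j) ->
  (upper_beurling_density (range lambda) < d%:E)%E ->
  forall o : int, exists a : int -> R, exists h : R -> R,
  [/\ exists M, forall k, `|a k| <= M,
      forall x, partial_sum
          (fun k : int => a k * gaussian gamma (x - beta * k%:~R))
        @ totally --> h x,
      forall k, h (lambda (o + 2 * k)) = 0 &
      forall k, h (lambda (o + 2 * k + 1)) != 0].
Proof.
move=> beta0 gamma0 d0 db incr dens o.
have [C HC] := increasing_gap_bound incr dens.
have inj : injective lambda.
  by move=> i j ij; have [/incr|/incr|//] := ltgtP i j; rewrite ij ltxx.
have bc : beta < 2 / d by rewrite ltr_pdivlMr// mulrC -ltr_pdivlMr.
have [||a [h [aM ah h0 hn0]]] := @gaussian_series_prescribed_zeros R beta gamma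
  (2 / d) (C + `|lambda o|)
  (fun j => lambda (o + 2 * j%:Z)) (fun j => lambda (o - 2 * (j.+1)%:Z))
  beta0 gamma0 bc.
- move=> j; have := HC o (2 * j)%N; rewrite PoszM mulrC -ler_pdivrMr// natrM.
  by have := ler_norm (- lambda o); rewrite normrN mulrAC; lra.
- move=> j; have := HC (o - 2 * (j.+1)%:Z) (2 * j.+1)%N.
  rewrite PoszM subrK mulrC -ler_pdivrMr// natrM -[j.+1%:R]natr1.
  rewrite mulrDr mulrDl mulr1 (mulrAC 2).
  have := ler_norm (lambda o); have : 0 < 2 / d by rewrite divr_gt0.
  lra.
exists a, h; split => //.
- case=> j; first by rewrite (h0 j).1.
  by rewrite NegzE mulrN (h0 j).2.
- move=> k; apply: hn0 => j; split; apply/eqP => /inj; lia.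
Qed.

(** * Independent functions of equal modulus on the sequence *)

Lemma Vinfty_real (R : realType) (beta gamma : R) (a : int -> R) (h : R -> R) :
  (exists M, forall k, `|a k| <= M) ->
  (forall x, partial_sum
      (fun k : int => a k * gaussian gamma (x - beta * k%:~R))
    @ totally --> h x) ->
  Vinfty beta gamma (fun x => (h x)%:C%C).
Proof.
have normC (x : R) : `|x%:C%C| = `|x|%:C%C.
  by rewrite normc_def /= expr0n addr0 sqrtr_sqr.
move=> [M aM] ah; exists (fun k => (a k)%:C%C); split.
  by exists M => k; rewrite normC lecR.
move=> x; apply/(@cvgrPdist_lt R[i] R[i]^o) => e; rewrite ltcE /= => /andP[/eqP Ime e0].
have /cvgrPdist_lt/(_ _ e0) := ah x; apply: filterS => B.
rewrite /partial_sum => hB.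
under eq_bigr do rewrite -rmorphM.
by rewrite -rmorph_sum -rmorphB normC ltcE /= Ime eqxx.
Qed.

Theorem mainTheorem2 (R : realType) (beta gamma : R)
    (beta_gt0 : 0 < beta) (gamma_gt0 : 0 < gamma)
    (lambda : int -> R)
    (lambda_incr : forall i j : int, i < j -> lambda i < lambda j)
    (lambda_sep : separated_set (range lambda))
    (D : \bar R)
    (lambda_dens : has_uniform_density (range lambda) D)
    (D_lt : (D < (2 * beta^-1)%:E)%E) :
  exists f g : R -> R[i],
    [/\ Vinfty beta gamma f /\ Vinfty beta gamma g,
        real_valued f /\ real_valued g,
        lin_indep2 f g
      & forall l : R, range lambda l -> `|f l| = `|g l|].
Proof.
have b20 : 0 < 2 / beta by rewrite divr_gt0.
have [d [d0 db Dd]] : exists d, [/\ 0 < d, d < 2 / beta & (D < d%:E)%E].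
  case: D D_lt {lambda_dens} => [r|//|_].
    (* The maximum with 0 ensures that the midpoint is positive. *)
    rewrite lte_fin => rb; exists ((Num.max r 0 + 2 / beta) / 2).
    have : Num.max r 0 < 2 / beta by rewrite gt_max rb.
    have : r <= Num.max r 0 by rewrite le_max lexx.
    have : 0 <= Num.max r 0 by rewrite le_max lexx orbT.
    by rewrite lte_fin; split; lra.
  by exists (2 / beta / 2); split; rewrite ?ltNyr//; lra.
have dens : (upper_beurling_density (range lambda) < d%:E)%E.
  by rewrite lambda_dens.2.
have zeros := alternate_zeros beta_gt0 gamma_gt0 d0 db lambda_incr dens.
have [a [u [[M aM] au u0 u1]]] := zeros 0.
have [b [v [[N bN] bv v0 v1]]] := zeros 1.
(* Used with e = 1 and e = -1. *)
have V (e : R) : Vinfty beta gamma (fun x => (u x + e * v x)%:C%C).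
  apply: (@Vinfty_real _ _ _ (fun k => a k + e * b k)).
    exists (M + `|e| * N) => k; apply: le_trans (ler_normD _ _) _.
    by rewrite normrM lerD// ler_wpM2l.
  move=> x; rewrite (_ : partial_sum _ = fun B =>
      partial_sum (fun k : int => a k * gaussian gamma (x - beta * k%:~R)) B +
      e * partial_sum (fun k : int => b k * gaussian gamma (x - beta * k%:~R)) B).
    by apply: cvgD; [exact: au | apply: cvgMl_tmp; exact: bv].
  apply/funext => B; rewrite /partial_sum mulr_sumr -big_split/=.
  by apply: eq_bigr => k _; rewrite mulrDl mulrA.
exists (fun x => (u x + 1 * v x)%:C%C), (fun x => (u x + -1 * v x)%:C%C).
split => //.
- by split=> x; rewrite complex_real.
- move=> p r pr.
  (* At [lambda 0] only [v] survives and forces p = r; at [lambda 1] only [u] survives and forces p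
     + r = 0. *)
  have := pr (lambda 0); have := pr (lambda 1).
  have := u0 0; have := u1 0; have := v0 0; have := v1 (-1).
  rewrite /= !mulr0 !addr0 !add0r => + -> + ->.
  rewrite !mulr0 !add0r !addr0 !mul1r.
  rewrite (_ : 1 + 2 * -1 + 1 = 0 :> int)// => v00 u10 pu pv.
  have : (p + r) * (u (lambda 1))%:C%C = 0 by rewrite mulrDl.
  have : (p - r) * (v (lambda 0))%:C%C = 0.
    by rewrite mulrBl -[RHS]pv mulN1r rmorphN mulrN.
  have nz (y : R) : y != 0 -> y%:C%C != 0 :> R[i] by rewrite eq_complex /= eqxx andbT.
  move=> /eqP; rewrite mulf_eq0 (negbTE (nz _ v00)) orbF subr_eq0 => /eqP ->.
  move=> /eqP; rewrite mulf_eq0 (negbTE (nz _ u10)) orbF -mulr2n mulrn_eq0 /=.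
  by move=> /eqP ->.
- move=> l [k _ <-].
  (* At even indices the two functions are v and -v; at odd indices both equal u. *)
  have [m [|]] : exists m : int, k = 0 + 2 * m \/ k = 1 + 2 * m.
    by exists (k %/ 2)%Z; lia.
  + by move=> ->; rewrite u0 !add0r mulN1r mul1r rmorphN normrN.
  + by move=> ->; rewrite v0 !mulr0.
Qed.
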